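(* Let $\lambda\in\mathbb{R}$, $w\in\mathcal{S}^2$, and let $a=\cos\lambda+w\sin\lambda\in\mathcal{S}^3\subset\mathbb{O}(1,1,1)$. Then for every $n\in\mathbb{Z}$, $$a^n=e^{n\lambda w}=(\cos\lambda+w\sin\lambda)^n=\cos n\lambda+w\sin n\lambda .$$
   Context: $\mathbb{O}(1,1,1)$ is the real octonion division algebra: the unital real algebra with basis $\{1,f_1,\dots,f_7\}$, $f_p^2=-1$ for all $p$, $f_pf_q=-f_qf_p$ for $p\ne q$, and $f_1f_2=f_3$, $f_1f_3=-f_2$, $f_1f_4=f_5$, $f_1f_5=-f_4$, $f_1f_6=-f_7$, $f_1f_7=f_6$, $f_2f_3=f_1$, $f_2f_4=f_6$, $f_2f_5=f_7$, $f_2f_6=-f_4$, $f_2f_7=-f_5$, $f_3f_4=f_7$, $f_3f_5=-f_6$, $f_3f_6=f_5$, $f_3f_7=-f_4$, $f_4f_5=f_1$, $f_4f_6=f_2$, $f_4f_7=f_3$, $f_5f_6=-f_3$, $f_5f_7=f_2$, $f_6f_7=-f_1$. It is power-associative, so powers of an element are well defined (negative powers are powers of the inverse). For $a=a_0+\sum_{p=1}^7a_pf_p$, the trace is $t(a)=2a_0$ and the norm is $N(a)=\sum_{p=0}^7a_p^2$. $\mathcal{S}^3=\{a\in\mathbb{O}(1,1,1):N(a)=1\}$ and $\mathcal{S}^2=\{a\in\mathbb{O}(1,1,1):t(a)=0,\ N(a)=1\}$. The exponential is $e^{x}=\sum_{m=0}^\infty x^m/m!$. *)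

(* Defs.v *)
From mathcomp Require Import all_boot all_order all_algebra.
From mathcomp Require Import all_classical all_reals all_analysis.

Set Implicit Arguments.
Unset Strict Implicit.
Unset Printing Implicit Defensive.

Import Order.TTheory GRing.Theory Num.Theory.
Import numFieldNormedType.Exports.

Local Open Scope classical_set_scope.
Local Open Scope ring_scope.

(* The real octonion division algebra O(1,1,1).  The carrier is R^8, the
   coordinate of index 0 being the scalar part; the additive, linear and
   topological structures are those of row vectors.  Mathematical Components
   defines no multiplication on 1 x 8 matrices, so omul is the only product. *)
Notation octonion R := 'rV[R]_8.

Section Octonions.
Variable R : realType.
Implicit Types x y : octonion R.

(* fb 0 is the unit 1, and fb p is the basis vector f_p for 1 <= p <= 7. *)
Definition fb (p : nat) : octonion R := \row_j (val j == p)%:R.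

Definition oone : octonion R := fb 0.

(* The products f_p f_q for 1 <= p < q <= 7; the default is never used. *)
Definition fmul_lt (p q : nat) : octonion R :=
  match p, q with
  | 1, 2 => fb 3 | 1, 3 => - fb 2 | 1, 4 => fb 5
  | 1, 5 => - fb 4 | 1, 6 => - fb 7 | 1, 7 => fb 6
  | 2, 3 => fb 1 | 2, 4 => fb 6 | 2, 5 => fb 7
  | 2, 6 => - fb 4 | 2, 7 => - fb 5
  | 3, 4 => fb 7 | 3, 5 => - fb 6 | 3, 6 => fb 5 | 3, 7 => - fb 4
  | 4, 5 => fb 1 | 4, 6 => fb 2 | 4, 7 => fb 3
  | 5, 6 => - fb 3 | 5, 7 => fb 2
  | 6, 7 => - fb 1
  | _, _ => 0
  end.

Definition fmul (p q : nat) : octonion R :=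
  if (p == 0)%N then fb q
  else if (q == 0)%N then fb p
  else if (p == q)%N then - oone
  else if (p < q)%N then fmul_lt p q
  else - fmul_lt q p.

Definition omul x y : octonion R :=
  \sum_(i < 8) \sum_(j < 8) (x ord0 i * y ord0 j) *: fmul i j.

Definition otrace x : R := 2 * x ord0 ord0.

(* The norm N is the quadratic form, not the topological norm `|x|. *)
Definition onorm x : R := \sum_(i < 8) x ord0 i ^+ 2.

Definition S3 : set (octonion R) := [set a | onorm a = 1].

Definition S2 : set (octonion R) := [set a | otrace a = 0 /\ onorm a = 1].

(* The two-sided inverse of x, and 0 by convention if there is none. *)
Definition oinv x : octonion R :=
  xget 0 [set y | omul x y = oone /\ omul y x = oone].

(* By power-associativity the bracketing of the powers is immaterial. *)
Definition oexpn x (n : nat) : octonion R := iter n (omul x) oone.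

(* Negz n stands for - (n + 1). *)
Definition oexpz x (n : int) : octonion R :=
  match n with
  | Posz n => oexpn x n
  | Negz n => oexpn (oinv x) n.+1
  end.

Definition oexp x : octonion R :=
  limn (series (fun m : nat => (m`!%:R)^-1 *: oexpn x m)).

End Octonions.

Arguments fb {R} p.
Arguments oone {R}.
Arguments S3 {R}.
Arguments S2 {R}.

(* Main.v *)
Require Import Defs.
From mathcomp Require Import all_boot all_order all_algebra.
From mathcomp Require Import all_classical all_reals all_analysis.
From mathcomp Require Import ring.

Import GRing.Theory Num.Theory.
Import numFieldNormedType.Exports.

Local Open Scope classical_set_scope.
Local Open Scope ring_scope.

(** Only the classical theory of the complex numbers is involved: a purely
    imaginary octonion [w] of norm 1 satisfies [w^2 = -1], so that
    [cos t + w sin t] behaves like [e^(it)].  Non-associativity is overcome by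
    one identity, [w (w x) = - N(w) x] for all [x] and all imaginary [w]
    ([omul_pureK]), an instance of left alternativity: it makes left
    multiplications by elements of the plane spanned by 1 and [w] compose as
    complex numbers multiply, even when applied to an octonion outside of that
    plane ([opolarK]).

    The angle addition formulas then give the natural powers.  For the negative
    powers, the inverse of [cos t + w sin t] has to be identified among all
    octonions, not only in the plane of 1 and [w]; left multiplication by
    [cos t - w sin t] cancels left multiplication by [cos t + w sin t], hence
    it is the only candidate ([oinv_opolar]).  For the exponential, the even
    powers of [mu w] are real and its odd powers are multiples of [w], with the
    signs of the cosine and sine series, so that the exponential series splits
    into these two convergent series ([oexp_pure]). *)

Section Octonion.
Variable R : realType.
Implicit Types (x y w : octonion R) (s t mu : R).

(** The bilinear extension of the multiplication table, written out: in this
    form an octonion identity is eight polynomial identities between real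
    coordinates. *)
Lemma omul_row x y (a := fun i => x ord0 (inord i))
    (b := fun i => y ord0 (inord i)) :
  omul x y = \row_(k < 8)
    nth 0
   [:: a 0%N * b 0%N - a 1%N * b 1%N - a 2%N * b 2%N - a 3%N * b 3%N
         - a 4%N * b 4%N - a 5%N * b 5%N - a 6%N * b 6%N - a 7%N * b 7%N
     ; a 0%N * b 1%N + a 1%N * b 0%N + a 2%N * b 3%N - a 3%N * b 2%N
         + a 4%N * b 5%N - a 5%N * b 4%N - a 6%N * b 7%N + a 7%N * b 6%N
     ; a 0%N * b 2%N + a 2%N * b 0%N - a 1%N * b 3%N + a 3%N * b 1%N
         + a 4%N * b 6%N - a 6%N * b 4%N + a 5%N * b 7%N - a 7%N * b 5%N
     ; a 0%N * b 3%N + a 3%N * b 0%N + a 1%N * b 2%N - a 2%N * b 1%N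
         + a 4%N * b 7%N - a 7%N * b 4%N - a 5%N * b 6%N + a 6%N * b 5%N
     ; a 0%N * b 4%N + a 4%N * b 0%N - a 1%N * b 5%N + a 5%N * b 1%N
         - a 2%N * b 6%N + a 6%N * b 2%N - a 3%N * b 7%N + a 7%N * b 3%N
     ; a 0%N * b 5%N + a 5%N * b 0%N + a 1%N * b 4%N - a 4%N * b 1%N
         - a 2%N * b 7%N + a 7%N * b 2%N + a 3%N * b 6%N - a 6%N * b 3%N
     ; a 0%N * b 6%N + a 6%N * b 0%N + a 1%N * b 7%N - a 7%N * b 1%N
         + a 2%N * b 4%N - a 4%N * b 2%N - a 3%N * b 5%N + a 5%N * b 3%N
     ; a 0%N * b 7%N + a 7%N * b 0%N - a 1%N * b 6%N + a 6%N * b 1%N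
         + a 2%N * b 5%N - a 5%N * b 2%N + a 3%N * b 4%N - a 4%N * b 3%N] k.
Proof.
apply/rowP => k; rewrite mxE summxE.
under eq_bigr => i _.
  rewrite summxE; under eq_bigr => j _.
    rewrite mxE -[i in x _ i]inord_val -[j in y _ j]inord_val; over.
  over.
rewrite !big_ord_recl !big_ord0 /fmul /bump /=.
by case: k => [[|[|[|[|[|[|[|[|//]]]]]]]] hk];
  rewrite /= !mxE /= /a /b; ring.
Qed.

Lemma omulDl x1 x2 y : omul (x1 + x2) y = omul x1 y + omul x2 y.
Proof.
rewrite -big_split; apply: eq_bigr => i _; rewrite -big_split.
by apply: eq_bigr => j _; rewrite mxE mulrDl scalerDl.
Qed.

Lemma omulZl t x y : omul (t *: x) y = t *: omul x y.
Proof.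
rewrite scaler_sumr; apply: eq_bigr => i _; rewrite scaler_sumr.
by apply: eq_bigr => j _; rewrite mxE scalerA mulrA.
Qed.

Lemma omulDr x y1 y2 : omul x (y1 + y2) = omul x y1 + omul x y2.
Proof.
rewrite -big_split; apply: eq_bigr => i _; rewrite -big_split.
by apply: eq_bigr => j _; rewrite mxE mulrDr scalerDl.
Qed.

Lemma omulZr t x y : omul x (t *: y) = t *: omul x y.
Proof.
rewrite scaler_sumr; apply: eq_bigr => i _; rewrite scaler_sumr.
by apply: eq_bigr => j _; rewrite mxE scalerA mulrCA.
Qed.

Lemma octonion_basis x : x = \sum_(j < 8) x ord0 j *: fb j.
Proof.
rewrite [LHS]row_sum_delta; apply: eq_bigr => j _.
by congr (_ *: _); apply/rowP => k; rewrite !mxE eqxx.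
Qed.

Lemma omul1x x : omul oone x = x.
Proof.
rewrite /omul big_ord_recl [X in _ + X]big1 ?addr0 => [|i _].
  by rewrite [RHS]octonion_basis; apply: eq_bigr => j _; rewrite mxE mul1r.
by rewrite big1 // => j _; rewrite mxE mul0r scale0r.
Qed.

Lemma omulx1 x : omul x oone = x.
Proof.
rewrite [RHS]octonion_basis; apply: eq_bigr => i _.
rewrite big_ord_recl [X in _ + X]big1 ?addr0 => [|j _].
  by rewrite mxE mulr1 /fmul /=; case: eqP => // ->.
by rewrite mxE mulr0 scale0r.
Qed.

Lemma onorm_sum x (a := fun i => x ord0 (inord i)) :
  onorm x = a 0%N ^+ 2 + a 1%N ^+ 2 + a 2%N ^+ 2 + a 3%N ^+ 2
          + a 4%N ^+ 2 + a 5%N ^+ 2 + a 6%N ^+ 2 + a 7%N ^+ 2.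
Proof.
rewrite /onorm; under eq_bigr do rewrite -[X in x _ X]inord_val.
by rewrite !big_ord_recl big_ord0 /bump /= addr0 !addrA.
Qed.

(** For imaginary [w], left alternativity [w (w x) = (w w) x] together with
    [w w = - N(w)].  The associator of [w], [w] and [x] is a polynomial in
    their coordinates, and the signs of the multiplication table make it
    vanish coordinatewise. *)
Lemma omul_pureK w x : w ord0 ord0 = 0 -> omul w (omul w x) = - onorm w *: x.
Proof.
rewrite -[ord0 in w _ ord0]inord_val /= => w0.
rewrite onorm_sum (omul_row w (omul w x)).
apply/rowP => k; rewrite -[in RHS](inord_val k) [LHS]mxE omul_row.
by case: k => [[|[|[|[|[|[|[|[|//]]]]]]]] hk];
  rewrite [LHS]/= !mxE /= !inordK //= w0; ring.
Qed.

Lemma onorm_reDim w s t : w ord0 ord0 = 0 ->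
  onorm (s *: oone + t *: w) = s ^+ 2 + t ^+ 2 * onorm w.
Proof.
move=> w0; rewrite /onorm big_ord_recl [in RHS]big_ord_recl !mxE /= w0.
rewrite mulr1 mulr0 addr0 expr0n add0r mulr_sumr; congr (_ + _); apply: eq_bigr => i _.
by rewrite !mxE mulr0 add0r exprMn.
Qed.

Definition opolar w t : octonion R := cos t *: oone + sin t *: w.

Section UnitImaginary.
Variable w : octonion R.
Hypothesis hw : S2 w.

Lemma S2_re0 : w ord0 ord0 = 0.
Proof. by case: hw => /eqP; rewrite /otrace mulf_eq0 pnatr_eq0 => /eqP. Qed.

Lemma S2_mulK x : omul w (omul w x) = - x.
Proof. by rewrite omul_pureK ?S2_re0 //; case: hw => _ ->; rewrite scaleN1r. Qed.

Lemma opolar_S3 t : S3 (opolar w t).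
Proof.
case: (hw) => _ w1; rewrite /S3 /= onorm_reDim ?S2_re0 // w1 mulr1.
exact: cos2Dsin2.
Qed.

Lemma opolar0 : opolar w 0 = oone.
Proof. by rewrite /opolar cos0 sin0 scale1r scale0r addr0. Qed.

(** Multiplication by [opolar w s] and [opolar w t] composes additively on any
    octonion [x], although [x], unlike [w], need not commute or associate with
    them; [S2_mulK] replaces associativity. *)
Lemma opolarK s t x :
  omul (opolar w s) (omul (opolar w t) x) = omul (opolar w (s + t)) x.
Proof.
rewrite /opolar !(omulDl, omulZl, omulDr, omulZr, omul1x) S2_mulK cosD sinD.
by apply/rowP => k; rewrite !mxE; ring.
Qed.

Lemma opolarD s t : omul (opolar w s) (opolar w t) = opolar w (s + t).
Proof. by rewrite -[opolar w t]omulx1 opolarK omulx1. Qed.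

(** An inverse [y] of [opolar w t] is determined by its being a right inverse:
    cancelling [opolar w t] on the left of the product gives
    [y = opolar w (- t)]. *)
Lemma oinv_opolar t : Defs.oinv (opolar w t) = opolar w (- t).
Proof.
apply: xget_unique => [|y [ty1 _]].
  by rewrite /= !opolarD subrr addNr opolar0.
by rewrite -[y]omul1x -opolar0 -(addNr t) -opolarK ty1 omulx1.
Qed.

Lemma oexpn_opolar t n : oexpn (opolar w t) n = opolar w (n%:R * t).
Proof.
elim: n => [|n IHn]; first by rewrite mul0r opolar0.
by rewrite /oexpn iterS -/(oexpn _ n) IHn opolarD -natr1 mulrDl mul1r addrC.
Qed.

Lemma oexpz_opolar t (n : int) : oexpz (opolar w t) n = opolar w (n%:~R * t).
Proof.
case: n => n; first exact: oexpn_opolar.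
by rewrite /oexpz oinv_opolar oexpn_opolar NegzE mulrNz mulrN mulNr.
Qed.

(** Since [w^2 = -1], the powers of [mu w] alternate between the line of 1 and
    that of [w]; the signs are those of the cosine and sine series. *)
Lemma oexpn_pure mu m :
  oexpn (mu *: w) m =
    if odd m then ((-1) ^+ m./2 * mu ^+ m) *: w
    else ((-1) ^+ m./2 * mu ^+ m) *: oone.
Proof.
elim: m => [|m IHm]; first by rewrite /= !expr0 mulr1 scale1r.
rewrite /oexpn iterS -/(oexpn _ m) {}IHm omulZl /= uphalf_half.
have ww : omul w w = - oone by rewrite -[X in omul w X]omulx1 S2_mulK.
case: (odd m); rewrite /= omulZr ?omulx1 ?ww scalerA.
  by rewrite scalerN -scaleNr; congr (_ *: _); rewrite add1n !exprS; ring.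
by congr (_ *: _); rewrite add0n exprS; ring.
Qed.

(** Euler's formula: the partial sums of the exponential series have the
    partial sums of [cos] and [sin] as coordinates along 1 and [w]. *)
Lemma oexp_pure mu : oexp (mu *: w) = opolar w mu.
Proof.
have termE : (fun m : nat => (m`!%:R)^-1 *: oexpn (mu *: w) m) =
    (fun m => cos_coeff mu m *: oone + sin_coeff mu m *: w).
  apply/funext => m; rewrite oexpn_pure cos_coeffE /sin_coeff /=.
  have [om|em] := ifPn.
    rewrite /= !mul0r scale0r add0r scalerA; congr (_ *: _).
    rewrite mul1r [RHS]mulrC; congr (_ * (_ ^+ _ * _)).
    (* For odd m, the exponent m.-1./2 of the sine series is m./2. *)
    by case: m om => //= m; rewrite uphalf_half => /negbTE ->.
  rewrite /= !mul0r scale0r addr0 scalerA; congr (_ *: _).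
  by rewrite mul1r mulrC mulrAC.
rewrite /oexp termE; apply: cvg_lim; first exact: norm_hausdorff.
rewrite (_ : series _ = (fun n => series (cos_coeff mu) n *: oone
                               + series (sin_coeff mu) n *: w)); last first.
  apply/funext => n; rewrite /series /= !scaler_suml.
  by rewrite -big_split.
rewrite /opolar unlock; apply: cvgD; apply: cvgZr_tmp.
  exact: is_cvg_series_cos_coeff.
by rewrite unlock; exact: is_cvg_series_sin_coeff.
Qed.

End UnitImaginary.
End Octonion.

Theorem proposition5p3 (R : realType) (lambda : R) (w a : octonion R)
    (hw : S2 w) (ha : a = cos lambda *: oone + sin lambda *: w) :
  S3 a /\
  forall n : int,
    [/\ oexpz a n = oexp ((n%:~R * lambda) *: w),
        oexp ((n%:~R * lambda) *: w)
          = oexpz (cos lambda *: oone + sin lambda *: w) n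
      & oexpz (cos lambda *: oone + sin lambda *: w) n
          = cos (n%:~R * lambda) *: oone + sin (n%:~R * lambda) *: w].
Proof.
rewrite {}ha -!/(opolar _ _); split=> [|n]; first exact: opolar_S3.
by rewrite -/(opolar _ _) oexp_pure // oexpz_opolar.
Qed.
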